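(* Let $\pi=(d_{1},\ldots,d_{n})$ be a non-increasing positive graphic sequence with $n$ even, let $k$ be a positive integer, and suppose $\mathcal{D}_{k}(\pi)=(d_{1}-k,\ldots,d_{n}-k)$ is graphic. If \[d_{n+1-(d_{1}-d_{n}+k)}\leq n-(d_{1}-d_{n}),\] then some realization of $\pi$ has $k$ pairwise edge-disjoint $1$-factors.
   Context: All graphs are finite and simple. A sequence is graphic if it is the degree sequence of some simple graph (a realization). Non-increasing means $d_1\ge\cdots\ge d_n$; positive means all $d_i\ge1$. A $1$-factor is a perfect matching (spanning $1$-regular subgraph). *)

(* Defs.v *)
From mathcomp Require Import all_boot all_order all_algebra.

Set Implicit Arguments.
Unset Strict Implicit.
Unset Printing Implicit Defensive.

Section Graphs.

Variable n : nat.

Definition simple_graph (e : rel 'I_n) : Prop := symmetric e /\ irreflexive e.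

Definition degree (e : rel 'I_n) (v : 'I_n) : nat := #|[set w | e v w]|.

(* The vertices are labelled so that vertex [i] has the [i]-th degree.
   Sequences have integer entries: those of [Dk] may a priori be negative. *)
Definition realizes (e : rel 'I_n) (s : n.-tuple int) : Prop :=
  simple_graph e /\ forall v : 'I_n, Posz (degree e v) = tnth s v.

Definition graphic (s : n.-tuple int) : Prop :=
  exists e : rel 'I_n, realizes e s.

Definition one_factor (e f : rel 'I_n) : Prop :=
  [/\ simple_graph f, subrel f e & forall v : 'I_n, degree f v = 1].

Definition edge_disjoint (f g : rel 'I_n) : Prop :=
  forall v w : 'I_n, ~~ (f v w && g v w).

Definition to_int (d : n.-tuple nat) : n.-tuple int := [tuple of map Posz d].

Definition Dk (k : nat) (d : n.-tuple nat) : n.-tuple int :=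
  [tuple of [seq (x - Posz k)%R | x <- to_int d]].

(* One-based: [entry d i] is d_i for 1 <= i <= n. *)
Definition entry (d : n.-tuple nat) (i : nat) : nat := nth 0 d i.-1.

End Graphs.

(* Main.v *)
Require Import Defs.
From mathcomp Require Import all_boot all_order all_algebra.
From mathcomp Require Import fingroup perm zify.
From Stdlib Require Import Classical.

Set Implicit Arguments.
Unset Strict Implicit.
Unset Printing Implicit Defensive.

(* The complement H of a realization of D_k(pi) has degrees spread over an
   interval of length s = d_1 - d_n, at least k of them everywhere, and at
   least s + k vertices of degree at least s + k - 1.  It is enough to find k
   disjoint 1-factors in some graph with the degrees of H: the complement of
   the rest of that graph then realizes pi.

   The 1-factors are split off one at a time.  Among all graphs with the given
   degrees, all choices of m disjoint 1-factors in them and all matchings M of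
   the rest Q, take M maximum, and then an M-unmatched vertex x of maximum
   degree.  Let D be the vertices other than x reached by even alternating
   walks from a second unmatched vertex.  Exchanging edges along the trails of
   two vertices shows that if z has t neighbours in D (along Q), then
   deg_Q z >= deg_Q x + t.  Hence D is independent in Q by the choice of x, so
   D has fewer than |D| neighbours, and some z has more Q-neighbours in D than
   the minimum degree of Q.  This forces deg_Q x < s.  Now the s + m + 1
   vertices of Q-degree at least s can never be left unmatched, and the same
   exchanges make all of them neighbours of z, whose degree is then too
   large. *)

(** * Edge-coloured complete graphs *)

Section Colorings.

Variable V : finType.
Implicit Types (c : V -> V -> nat) (q : V -> nat) (Y : {set V}).

(* Colour 0 marks the non-edges, colour 1 the rest and the colours from 2 to
   [m + 1] the 1-factors already split off. *)
Record coloring (m : nat) q c : Prop := Coloring {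
  col_sym : forall v w, c v w = c w v;
  col_diag : forall v, c v v = 0;
  col_le : forall v w, c v w <= m.+1;
  col_rest : forall v, #|[set w | c v w == 1]| = q v;
  col_factor : forall v j, 1 < j <= m.+1 -> #|[set w | c v w == j]| = 1 }.

(** Meant for [a] and [b] outside [Y]: the pairs [a y] and [b y] then trade colours for each [y] in
    [Y], and nothing else changes. *)
Definition swap c (a b : V) Y (v w : V) : nat :=
  if w \in Y then c (tperm a b v) w
  else if v \in Y then c v (tperm a b w) else c v w.

(** The rows of [a] and [b] trade the two sets compared in the hypothesis, a row in [Y] is permuted
    by the transposition, and other rows stay as they are. *)
Lemma swap_card c a b Y i v :
  a \notin Y -> b \notin Y ->
  #|[set y in Y | c a y == i]| = #|[set y in Y | c b y == i]| ->
  #|[set w | swap c a b Y v w == i]| = #|[set w | c v w == i]|.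
Proof.
move=> aY bY bal.
have tY w : w \in Y -> tperm a b w = w.
  by move=> wY; rewrite tpermD //; apply: contraTneq wY => <-.
have ends u t : #|[set y in Y | c t y == i]| = #|[set y in Y | c u y == i]| ->
    u \notin Y -> tperm a b u = t ->
    #|[set w | swap c a b Y u w == i]| = #|[set w | c u w == i]|.
  move=> balut uY tu.
  rewrite -(cardsID Y) -[RHS](cardsID Y); congr (_ + _).
    transitivity #|[set y in Y | c t y == i]|.
      apply: eq_card => w; rewrite !inE /swap tu andbC.
      by case: (w \in Y).
    by rewrite balut; apply: eq_card => w; rewrite !inE andbC.
  apply: eq_card => w; rewrite !inE /swap (negbTE uY).
  by case: (w \in Y).
have [->|va] := eqVneq v a; first by apply: (ends a b); rewrite ?tpermL.
have [->|vb] := eqVneq v b; first by apply: (ends b a); rewrite ?tpermR.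
have tv : tperm a b v = v by rewrite tpermD // eq_sym.
have [vY|vY] := boolP (v \in Y); last first.
  apply: eq_card => w; rewrite !inE /swap (negbTE vY) tv.
  by case: ifP.
rewrite -[RHS](card_imset _ (@perm_inj _ (tperm a b))).
apply: eq_card => w; rewrite !inE /swap vY tv.
rewrite -[w in RHS](tpermK a b) mem_imset; last exact: perm_inj.
by rewrite inE; case: ifP => // /tY ->.
Qed.

Lemma swap_coloring m q c a b Y :
  coloring m q c -> a \notin Y -> b \notin Y ->
  (forall i, 0 < i ->
     #|[set y in Y | c a y == i]| = #|[set y in Y | c b y == i]|) ->
  coloring m q (swap c a b Y).
Proof.
move=> cP aY bY bal.
have tY w : w \in Y -> tperm a b w = w.
  by move=> wY; rewrite tpermD //; apply: contraTneq wY => <-.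
split.
- move=> v w; rewrite /swap.
  have [wY|wY] := boolP (w \in Y); have [vY|vY] := boolP (v \in Y).
  + by rewrite !tY // (col_sym cP).
  + exact: (col_sym cP).
  + exact: (col_sym cP).
  + exact: (col_sym cP).
- move=> v; rewrite /swap.
  by have [vY|_] := boolP (v \in Y); rewrite ?tY // (col_diag cP).
- by move=> v w; rewrite /swap; case: ifP => _; [|case: ifP => _];
    exact: (col_le cP).
- by move=> v; rewrite swap_card ?bal // (col_rest cP).
- move=> v j jm; rewrite swap_card ?bal ?(col_factor cP) //.
  by case/andP: jm => /ltnW.
Qed.

Lemma card_setsum (P : pred V) Y :
  #|[set y in Y | P y]| = \sum_(y in Y) (P y : nat).
Proof.
rewrite -sum1_card big_mkcond [RHS]big_mkcond; apply: eq_bigr => y _.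
by rewrite inE; case: (y \in Y); case: (P y).
Qed.

Lemma card_by_color m q c v Y : coloring m q c ->
  #|Y| = #|[set y in Y | c v y < 2]|
         + \sum_(j < m) #|[set y in Y | c v y == j.+2]|.
Proof.
move=> cP; under eq_bigr => j _ do rewrite card_setsum.
rewrite exchange_big card_setsum -big_split /= -sum1_card.
apply: eq_bigr => y _; have := col_le cP v y.
case: (c v y) => [|[|x]] xm; [by rewrite big1 | by rewrite big1 |].
rewrite (bigD1 (Ordinal (xm : x < m))) //= eqxx big1 // => j.
by rewrite -val_eqE /= !eqSS eq_sym => /negbTE ->.
Qed.

Lemma color_uniq m q c v w w' : coloring m q c ->
  1 < c v w -> c v w' = c v w -> w' = w.
Proof.
move=> cP c1 cw; have := col_factor cP v (j := c v w).
rewrite c1 (col_le cP) => /(_ isT)/eqP/cards1P[x xP].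
have: w \in [set x] by rewrite -xP inE.
have: w' \in [set x] by rewrite -xP inE cw.
by rewrite !inE => /eqP -> /eqP ->.
Qed.

Lemma card_colored m q c v : coloring m q c ->
  #|[set w | 0 < c v w]| = q v + m.
Proof.
move=> cP; rewrite (card_by_color v [set w | 0 < c v w] cP); congr (_ + _).
  rewrite -(col_rest cP v); apply: eq_card => w; rewrite !inE.
  by case: (c v w) => [|[]].
transitivity (\sum_(j < m) 1); last by rewrite sum1_card card_ord.
apply: eq_bigr => j _; rewrite -[RHS](col_factor cP v (j := j.+2));
  last by rewrite /= !ltnS.
by apply: eq_card => w; rewrite !inE; case: eqP => [->|]; rewrite ?andbF.
Qed.

End Colorings.

(** * Exchanges along trails *)

Section Trails.

Variables (V : finType) (m : nat) (q : V -> nat) (c : V -> V -> nat) (a b : V).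
Hypotheses (cP : coloring m q c) (ab : a != b).

Definition inner : {set V} := ~: [set a; b].

(* Each colour above 1 occurs once at [a] and once at [b], so a trail is
   followed deterministically until it reaches colour 0 or 1 at [b]. *)
Definition trail_step : rel V := fun y z =>
  [&& y \in inner, z \in inner, 1 < c a z & c b y == c a z].

Definition trail (y : V) : {set V} := [set z | connect trail_step y z].

Lemma innerP y : reflect (y != a /\ y != b) (y \in inner).
Proof. by rewrite !inE negb_or; exact: andP. Qed.

Lemma trail_step_uniq y y' z : trail_step y z -> trail_step y' z -> y = y'.
Proof.
case/and4P=> _ _ z1 /eqP yz /and4P[_ _ _ /eqP y'z].
by apply: (color_uniq cP (v := b)); rewrite y'z // yz.
Qed.

Lemma trail_inner y : y \in inner -> trail y \subset inner.
Proof.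
move=> yI; apply/subsetP => z; rewrite inE => /connectP[p].
elim: p y yI => [|x p IH] y yI /=; first by move=> _ ->.
by case/andP=> /and4P[_ xI _ _]; exact: IH.
Qed.

Lemma trail_start y z : z \in trail y -> c a z < 2 -> z = y.
Proof.
rewrite inE => /connectP[p]; case/lastP: p => [_ -> //|p x].
rewrite rcons_path last_rcons => /andP[_ /and4P[_ _ x1 _]] -> cz.
by rewrite ltnNge x1 in cz.
Qed.

(** Going backwards, predecessors are unique, and the start has none because steps only enter
    vertices of colour above 1 at [a]. *)
Lemma trail_closed y : c a y < 2 -> closed trail_step (trail y).
Proof.
move=> cy z z' zz'; rewrite !inE; apply/idP/idP => [yz|].
  exact: connect_trans yz (connect1 zz').
case/connectP=> p; case/lastP: p => [_ /= z'y|p x].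
  by case/and4P: zz' => _ _; rewrite z'y ltnNge -ltnS cy.
rewrite rcons_path last_rcons => /andP[py xz] z'x; subst x.
by apply/connectP; exists p; rewrite // (trail_step_uniq zz' xz).
Qed.

Lemma card_color1 (Y : {set V}) v w : 1 < c v w ->
  #|[set y in Y | c v y == c v w]| = (w \in Y).
Proof.
move=> cw; have sub y : c v y == c v w -> y = w.
  by move/eqP; exact: (color_uniq cP cw).
have [wY|wY] := boolP (w \in Y); last first.
  apply: eq_card0 => y; rewrite !inE; apply/negP => /andP[yY /sub yw].
  by rewrite yw (negbTE wY) in yY.
rewrite (_ : [set y in Y | _] = [set w]) ?cards1 //; apply/setP => y.
rewrite !inE; apply/andP/eqP => [[_ /sub]//|->]; by [].
Qed.

Lemma color_exists v j : 1 < j <= m.+1 -> exists w, c v w = j.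
Proof.
move/(col_factor cP v)/eqP/cards1P => [w wP]; exists w.
by apply/eqP; have := set11 w; rewrite -wP inE.
Qed.

(** Within [inner], the only vertex [x] of colour [j] at [b] steps to the only vertex [w] of colour
    [j] at [a], so a closed set contains both or neither. *)
Lemma closed_balanced (Y : {set V}) j :
  Y \subset inner -> closed trail_step Y -> 1 < j ->
  #|[set y in Y | c a y == j]| = #|[set y in Y | c b y == j]|.
Proof.
move=> /subsetP YI cY j1; have [jm|jm] := leqP j m.+1; last first.
  have jE v y : (c v y == j) = false.
    by apply/eqP => cj; have := col_le cP v y; rewrite cj leqNgt jm.
  by rewrite !eq_card0 // => y; rewrite !inE jE andbF.
have jj : 1 < j <= m.+1 by rewrite j1.
have [w cw] := color_exists a jj; have [x cx] := color_exists b jj.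
rewrite -{1}cw -cx !card_color1 ?cw ?cx //.
have aY : a \notin Y by apply/negP => /YI/innerP[]; rewrite eqxx.
have bY : b \notin Y by apply/negP => /YI/innerP[]; rewrite eqxx.
(* In this case the pair [a b] itself has colour [j], and both its ends are outside [Y]. *)
have [wb|wb] := eqVneq w b.
  rewrite -(_ : a = x) ?wb ?(negbTE aY) ?(negbTE bY) //.
  by apply: (color_uniq cP (v := b)); rewrite cx // (col_sym cP) -wb.
congr nat_of_bool; apply/esym/cY; rewrite /trail_step cw cx j1 eqxx !andbT.
apply/andP; split; apply/innerP; split=> //; apply/eqP => E.
- have cab : c a b = j by rewrite (col_sym cP) -E.
  by move/eqP: wb; apply; apply: (color_uniq cP (v := a)); rewrite cab ?cw.
- by rewrite -cx E (col_diag cP) in j1.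
- by rewrite -cw E (col_diag cP) in j1.
Qed.

(** Both sides are what remains of [#|Y|] after removing the colours above 1, which are balanced. *)
Lemma closed_hub (Y : {set V}) :
  Y \subset inner -> closed trail_step Y ->
  #|[set y in Y | c a y < 2]| = #|[set y in Y | c b y < 2]|.
Proof.
move=> YI cY; apply/eqP; rewrite -(eqn_add2r
  (\sum_(j < m) #|[set y in Y | c a y == j.+2]|)) -(card_by_color _ _ cP).
under eq_bigr => j _ do rewrite closed_balanced //.
by rewrite -(card_by_color _ _ cP).
Qed.

(** The start is the only vertex of the trail with colour below 2 at [a]; [closed_hub] turns this
    into a unique end at [b]. *)
Lemma trail_hub y : y \in inner -> c a y < 2 ->
  #|[set z in trail y | c b z < 2]| = 1.
Proof.
move=> yI cy; rewrite -closed_hub ?trail_inner //; last exact: trail_closed.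
apply/eqP/cards1P; exists y; apply/setP => z; rewrite in_set in_set1.
apply/andP/eqP => [[zy cz]|->]; first exact: trail_start zy cz.
by rewrite inE connect0.
Qed.

(* A matching of the rest avoiding [b] and the edge [a y0] survives in [c'],
   where [b y0] has become available. *)
Definition transfer y0 := exists c',
  [/\ coloring m q c', c' b y0 = 1
    & forall v w, v != b -> w != b -> c v w = 1 ->
        (v, w) <> (a, y0) -> (v, w) <> (y0, a) -> c' v w = 1].

(** Swapping on [Y] is balanced in every positive colour, and [a y0] is the only pair of colour 1
    avoiding [b] that it can destroy. *)
Lemma transfer_closed y0 (Y : {set V}) :
  Y \subset inner -> closed trail_step Y -> y0 \in Y ->
  [set y in Y | c a y == 1] = [set y0] ->
  #|[set y in Y | c b y == 1]| = 1 -> transfer y0.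
Proof.
move=> YI cY yY aY1 bY1; exists (swap c a b Y).
have aY : a \notin Y.
  by apply/negP => /(subsetP YI)/innerP[]; rewrite eqxx.
have bY : b \notin Y.
  by apply/negP => /(subsetP YI)/innerP[]; rewrite eqxx.
have ca : c a y0 = 1.
  by apply/eqP; have := set11 y0; rewrite -aY1 inE => /andP[].
have only y : y \in Y -> c a y = 1 -> y = y0.
  by move=> yY' cy; apply/set1P; rewrite -aY1 inE yY' cy eqxx.
split.
- apply: (swap_coloring cP) => // -[|[|j]] // _; last exact: closed_balanced.
  by rewrite aY1 cards1 bY1.
- by rewrite /swap yY tpermR.
move=> v w vb wb cvw ne1 ne2; rewrite /swap.
have [wY|wY] := boolP (w \in Y).
  have [va|va] := eqVneq v a; last by rewrite tpermD // eq_sym.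
  by case: ne1; rewrite -(only w) -?va.
have [vY|//] := boolP (v \in Y).
have [wa|wa] := eqVneq w a; last by rewrite tpermD // eq_sym.
by case: ne2; rewrite -(only v) -?wa // (col_sym cP).
Qed.

Lemma only_hub_1 y z : y \in inner -> c a y < 2 -> z \in trail y ->
  c b z < 2 -> #|[set x in trail y | c b x == 1]| = (c b z == 1).
Proof.
move=> yI cy zy cz; have /eqP/cards1P[x xP] := trail_hub yI cy.
have zx : z = x by apply/set1P; rewrite -xP inE zy cz.
subst x; case: eqP => [z1|z1].
  apply/eqP/cards1P; exists z; rewrite -xP; apply/setP => w; rewrite !inE.
  apply/andP/andP => -[wy]; first by move/eqP->.
  move=> cw; have /set1P -> : w \in [set z] by rewrite -xP !inE wy.
  by rewrite z1; move: zy; rewrite inE => ->.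
rewrite eq_card0 // => w; rewrite inE; apply/negP => /andP[wy /eqP cw].
by apply: z1; rewrite -cw; congr c; apply/esym/set1P; rewrite -xP inE wy cw.
Qed.

(** If the trail of [y0] ends in colour 1 at [b], it is exchanged alone. Otherwise it ends in colour
    0, and adding the trail of a non-neighbour [y] of [a] that ends in colour 1 restores the
    balance. *)
Lemma transfer_trail y0 y z : y0 != b -> c a y0 = 1 ->
  y = y0 \/ y \in inner /\ c a y = 0 ->
  z \in trail y -> c b z = 1 -> transfer y0.
Proof.
move=> y0b cy0.
have y0I : y0 \in inner.
  by apply/innerP; split=> //; apply/eqP => E; rewrite E (col_diag cP) in cy0.
have cy0' : c a y0 < 2 by rewrite cy0.
have single w : w \in trail y0 -> c b w = 1 -> transfer y0.
  move=> wy cw; apply: (transfer_closed (trail_inner y0I)).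
  - exact: trail_closed.
  - by rewrite inE connect0.
  - apply/setP => x; rewrite in_set in_set1.
    apply/andP/eqP => [[xy /eqP cx]|->].
      by apply: trail_start xy _; rewrite cx.
    by rewrite inE connect0 cy0.
  by rewrite (only_hub_1 y0I cy0' wy) cw.
case=> [->|[yI cy]] zy cz; first exact: single zy cz.
have cy' : c a y < 2 by rewrite cy.
have cz' : c b z < 2 by rewrite cz.
have /eqP/cards1P[w wP] := trail_hub y0I cy0'.
have /andP[wy0 cw] : (w \in trail y0) && (c b w < 2).
  by have := set11 w; rewrite -wP inE.
have [cw1|cw1] := eqVneq (c b w) 1; first exact: single wy0 cw1.
(* A common vertex would put [y] on the trail of [y0], and then force [y = y0]. *)
have dis : trail y0 :&: trail y = set0.
  apply/setP => x; rewrite in_setI in_set0; apply/negP => /andP[x0 x1].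
  have yy0 : y \in trail y0.
    move: x1; rewrite inE => /connectP[p pp xE].
    have: closed trail_step (trail y0) by exact: trail_closed.
    move/closed_connect => clo; rewrite (clo _ x) //.
    by apply/connectP; exists p.
  have /trail_start/(_ cy') yE := yy0.
  by rewrite yE cy0 in cy.
apply: (@transfer_closed y0 (trail y0 :|: trail y)).
- by rewrite subUset !trail_inner.
- move=> x x' xx'; rewrite !in_setU.
  by rewrite (trail_closed cy0' xx') (trail_closed cy' xx').
- by rewrite in_setU inE connect0.
- apply/setP => x; rewrite in_set in_set1 in_setU; apply/andP/eqP.
    case=> /orP[] xy /eqP cx; first by apply: trail_start xy _; rewrite cx.
    have xy' : x = y by apply: trail_start xy _; rewrite cx.
    by rewrite xy' cy in cx.
  by move=> ->; rewrite inE connect0 cy0.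
have -> : [set x in trail y0 :|: trail y | c b x == 1] =
    [set x in trail y0 | c b x == 1] :|: [set x in trail y | c b x == 1].
  by apply/setP => x; rewrite in_setU !in_set -andb_orl.
rewrite cardsU (only_hub_1 y0I cy0' wy0 cw) (negbTE cw1).
rewrite (only_hub_1 yI cy' zy cz') cz eqxx (_ : _ :&: _ = set0) ?cards0 //.
apply/setP => x; rewrite in_setI in_set0; apply/negP.
rewrite !in_set => /andP[/andP[x0 _] /andP[x1 _]].
by have := in_set0 x; rewrite -dis in_setI !in_set x0 x1.
Qed.

(* Trails leaving [T] or a non-neighbour of [a] never end in a neighbour of
   [b]; the remaining ones send [N(b)] injectively into [N(a)] minus [T]. *)
Lemma transfer_count (T : {set V}) (y0 : V) :
  y0 \in T ->
  (forall y, y \in T -> [/\ y != b, c a y = 1 & ~ transfer y]) ->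
  q b + #|T| <= q a.
Proof.
move=> y0T TP.
pose P := T :|: [set y in inner | c a y == 0].
pose U := \bigcup_(y in P) trail y.
have PI y : y \in P -> y \in inner /\ c a y < 2.
  rewrite in_setU => /orP[/TP[yb cy _]|]; last first.
    by rewrite in_set => /andP[-> /eqP ->].
  rewrite cy; split=> //; apply/innerP; split=> //.
  by apply/eqP => E; rewrite E (col_diag cP) in cy.
have UC : closed trail_step U.
  move=> x x' xx'; apply/bigcupP/bigcupP => -[y yP];
    have [_ cy] := PI y yP; have E := trail_closed cy xx'.
    by rewrite E; exists y.
  by rewrite -E; exists y.
pose W := inner :\: U.
have WI : W \subset inner by exact: subsetDl.
have WC : closed trail_step W.
  move=> x x' xx'; rewrite !in_setD (UC _ _ xx').
  by case/and4P: xx' => -> ->.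
have bW : [set y in inner | c b y == 1] \subset [set y in W | c b y < 2].
  apply/subsetP => z; rewrite in_set => /andP[zI /eqP cz].
  rewrite in_set in_setD zI cz !andbT; apply/negP => /bigcupP[y yP zy].
  have [y0b cy0 []] := TP y0 y0T.
  move: yP; rewrite in_setU => /orP[yT|].
    have [yb cy] := TP y yT; case.
    exact: (transfer_trail yb cy (or_introl erefl) zy cz).
  rewrite in_set => /andP[yI /eqP cy].
  by apply: (transfer_trail y0b cy0 _ zy cz); right.
have aW : [set y in W | c a y < 2] \subset
    [set y in inner | c a y == 1] :\: T.
  apply/subsetP => y; rewrite in_set => /andP[/setDP[yI yU] cy].
  rewrite in_setD in_set yI.
  have yP : y \notin P.
    by apply: contra yU => yP; apply/bigcupP; exists y; rewrite // inE connect0.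
  move: yP; rewrite in_setU negb_or => /andP[-> ]; rewrite in_set yI /=.
  by case: (c a y) cy => [|[]].
have := subset_leq_card bW; rewrite -closed_hub // => /leq_trans.
move/(_ _ (subset_leq_card aW)).
have TI : T \subset [set y in inner | c a y == 1].
  apply/subsetP => y yT; have [_ cy _] := TP y yT.
  have yP : y \in P by rewrite in_setU yT.
  by rewrite in_set cy (PI y yP).1.
rewrite cardsD (setIidPr TI).
have := subset_leq_card TI.
(* [inner] leaves out the pair [a b], which adds the same amount to both degrees. *)
have inn u v : u != v -> [set u; v] = [set a; b] ->
    q u = #|[set y in inner | c u y == 1]| + (c u v == 1).
  move=> uv uvE; rewrite -(col_rest cP u) (cardsD1 v) inE addnC; congr (_ + _).
  rewrite /inner -uvE; apply: eq_card => y; rewrite !inE negb_or.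
  by have [->|] := eqVneq y u; rewrite ?(col_diag cP) ?andbF //= .
rewrite (inn a b) // (inn b a) 1?eq_sym //; last by rewrite setUC.
rewrite (col_sym cP b a); lia.
Qed.

End Trails.

(** * Matchings of the rest *)

Section Matchings.

Variable V : finType.
Implicit Types (c : V -> V -> nat) (M : V -> V) (v w z : V).

(* A matching is an involution whose fixed points are the unmatched vertices. *)
Definition matching c M : Prop :=
  involutive M /\ forall v, M v != v -> c v (M v) = 1.

Definition unmatched M : {set V} := [set v | M v == v].

Definition link M v w z : V :=
  if z == v then w else if z == w then v else M z.

Definition unlink M v z : V := if (z == v) || (z == M v) then z else M z.

(* [w], unmatched so far, takes over the partner of [v]. *)
Definition shift M v w : V -> V := link (unlink M v) w (M v).

Lemma link_inv M v w :
  involutive M -> M v = v -> M w = w -> involutive (link M v w).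
Proof.
move=> Mi Mv Mw z; rewrite /link.
have [->|zv] := eqVneq z v; first by rewrite eqxx; case: eqP.
have [->|zw] := eqVneq z w; first by rewrite eqxx.
by rewrite !(inv_eq Mi) Mv Mw (negbTE zv) (negbTE zw).
Qed.

Lemma unlink_inv M v : involutive M -> involutive (unlink M v).
Proof.
move=> Mi z; rewrite /unlink.
case E: ((z == v) || (z == M v)); first by rewrite E.
by rewrite (inv_eq Mi) (inj_eq (inv_inj Mi)) orbC E.
Qed.

Lemma unmatched_link M v w : M v = v -> M w = w -> v != w ->
  #|unmatched M| = #|unmatched (link M v w)|.+2.
Proof.
move=> Mv Mw vw; have wv : w == v = false by rewrite eq_sym (negbTE vw).
rewrite (cardsD1 v) inE Mv eqxx (cardsD1 w) !inE Mw eqxx wv.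
congr _.+2; apply: eq_card => z; rewrite !inE /link.
have [->|zw] := eqVneq z w; first by rewrite wv (negbTE vw).
by have [->|zv] := eqVneq z v; first by rewrite wv.
Qed.

Lemma unmatched_unlink M v : involutive M -> M v != v ->
  #|unmatched (unlink M v)| = #|unmatched M|.+2.
Proof.
move=> Mi Mv.
rewrite (cardsD1 v) (cardsD1 (M v)) !inE /unlink !eqxx orbT Mv !eqxx /=.
congr _.+2; apply: eq_card => z; rewrite !inE.
have [->|zMv] := eqVneq z (M v).
  by rewrite Mi [v == _]eq_sym (negbTE Mv).
by have [->|zv] := eqVneq z v; rewrite //= (negbTE Mv).
Qed.

(** The enumeration order selects one end of each matched pair; [M] maps these ends, [lo], onto the
    others. *)
Lemma odd_unmatched M : involutive M -> odd #|unmatched M| = odd #|V|.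
Proof.
move=> Mi; rewrite -(cardsC (unmatched M)) oddD.
pose lo := [set v | enum_rank v < enum_rank (M v)].
rewrite -(cardsID lo (~: unmatched M)) (_ : _ :&: _ = lo); last first.
  apply/setP => v; rewrite !inE andbC; case: ltngtP => //= lt.
  by apply/eqP => E; rewrite E ltnn in lt.
rewrite (_ : _ :\: _ = M @: lo) ?card_imset ?oddD ?addbb ?addbF //.
  exact: inv_inj.
apply/setP => v.
have := mem_imset lo (M v) (inv_inj Mi); rewrite Mi => ->; rewrite !inE Mi.
case: ltngtP => //= [lt|/val_inj/enum_rank_inj <-]; last by rewrite eqxx.
by apply/eqP => E; rewrite E ltnn in lt.
Qed.

Lemma matching_link c c' M v w :
  matching c M -> (forall v w, c' v w = c' w v) ->
  M v = v -> M w = w -> c' v w = 1 ->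
  (forall z, z != v -> z != w -> c z (M z) = 1 -> c' z (M z) = 1) ->
  matching c' (link M v w).
Proof.
move=> [Mi cM] sym' Mv Mw vw keep; split; first exact: link_inv.
move=> z; rewrite /link.
have [->|zv] := eqVneq z v; first by [].
have [->|zw] := eqVneq z w; first by rewrite sym'.
by move/cM/keep; apply.
Qed.

Section Shift.

Variables (M : V -> V) (v w : V).
Hypotheses (Mi : involutive M) (Mv : M v != v) (Mw : M w = w).

Let vw : v != w. Proof. by apply: contraNneq Mv => ->; rewrite Mw. Qed.
Let Mvw : M v != w. Proof. by rewrite (inv_eq Mi) Mw. Qed.

Lemma shift_fix : shift M v w v = v.
Proof. by rewrite /shift /link /unlink (negbTE vw) eq_sym (negbTE Mv) eqxx. Qed.

Lemma shift_id z : z != v -> z != w -> z != M v -> shift M v w z = M z.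
Proof.
move=> zv zw zMv.
by rewrite /shift /link /unlink !(negbTE zw, negbTE zMv, negbTE zv).
Qed.

Let uMv : unlink M v (M v) = M v. Proof. by rewrite /unlink eqxx orbT. Qed.
Let uw : unlink M v w = w. Proof. by rewrite /unlink Mw; case: ifP. Qed.

Lemma unmatched_shift : #|unmatched (shift M v w)| = #|unmatched M|.
Proof.
have := unmatched_link uw uMv; rewrite eq_sym Mvw (unmatched_unlink Mi Mv).
by case/(_ isT).
Qed.

Lemma matching_shift c c' :
  matching c M -> (forall v w, c' v w = c' w v) -> c' w (M v) = 1 ->
  (forall z, z != v -> z != w -> z != M v -> c z (M z) = 1 -> c' z (M z) = 1) ->
  matching c' (shift M v w).
Proof.
move=> [_ cM] sym' cw keep.
split; first by apply: link_inv => //; exact: unlink_inv.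
move=> z; have [->|zv] := eqVneq z v; first by rewrite shift_fix eqxx.
have [->|zw] := eqVneq z w; first by rewrite /shift /link eqxx.
have [->|zMv] := eqVneq z (M v).
  by rewrite /shift /link eqxx (negbTE Mvw) sym'.
by rewrite shift_id // => /cM; exact: keep.
Qed.

End Shift.

End Matchings.

(** * Maximum matchings that are not perfect *)

(** The last vertex is never the source of a step; this suits an induction in which it is not yet
    known to be missed. *)
Lemma sub_belast_path (T : eqType) (e e' : rel T) x p :
  (forall s t, s \in belast x p -> t \in p -> e s t -> e' s t) ->
  path e x p -> path e' x p.
Proof.
elim: p x => //= t p IH x sub /andP[xt tp].
rewrite sub ?mem_head //=; apply: IH tp => s r sp rp.
by apply: sub; rewrite inE ?sp ?rp orbT.
Qed.

Section Deficient.

Variables (V : finType) (m : nat) (q : V -> nat) (c : V -> V -> nat).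
Variables (M : V -> V) (x : V).
Hypotheses (cP : coloring m q c) (MP : matching c M) (Mx : M x = x).
Hypothesis M_max : forall c' M', coloring m q c' -> matching c' M' ->
  #|unmatched M| <= #|unmatched M'|.
Hypothesis x_max : forall c' M' v, coloring m q c' -> matching c' M' ->
  #|unmatched M'| = #|unmatched M| -> M' v = v -> q v <= q x.

Definition missed (w : V) : Prop := w != x /\ exists M' : V -> V,
  [/\ matching c M', #|unmatched M'| = #|unmatched M|, M' x = x & M' w = w].

Lemma no_augment c' M' v w : coloring m q c' -> matching c M' ->
  #|unmatched M'| = #|unmatched M| -> M' v = v -> M' w = w -> v != w ->
  c' v w = 1 ->
  ~ (forall z, z != v -> z != w -> c z (M' z) = 1 -> c' z (M' z) = 1).
Proof.
move=> c'P M'P M'M vv ww vw cvw keep.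
have := M_max c'P (matching_link M'P (col_sym c'P) vv ww cvw keep).
by rewrite -M'M (unmatched_link vv ww vw) ltnNge leqnSn.
Qed.

Lemma missed_rest w : missed w -> c w x != 1.
Proof.
case=> wx [M' [M'P M'M xx ww]]; apply/eqP => cwx.
by apply: (no_augment cP M'P M'M ww xx wx cwx).
Qed.

(** A matching missing both [x] and [w] survives the transfer, after which the new edge [x w] would
    enlarge it. *)
Lemma missed_no_transfer a w : a != x -> missed w -> ~ transfer m q c a x w.
Proof.
move=> ax [wx [M' [M'P M'M xx ww]]] [c' [c'P cxw keep]].
have M'i := M'P.1.
apply: (no_augment c'P M'P M'M xx ww _ cxw); first by rewrite eq_sym.
move=> z zx zw czM; apply: keep => //.
- by rewrite (inv_eq M'i) xx.
- by case=> _ zE; move: zw; rewrite -ww -zE M'i eqxx.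
- by case=> zE; rewrite zE eqxx in zw.
Qed.

Lemma missed_degree (T : {set V}) w z : z != x -> w \in T ->
  (forall y, y \in T -> missed y /\ c z y = 1) -> q x + #|T| <= q z.
Proof.
move=> zx wT TP; apply: (transfer_count cP zx wT) => y /TP[ym cy].
by split=> //; [case: ym | exact: missed_no_transfer].
Qed.

(** An edge would give [q x < q z] by [missed_degree], although [z] competes with [x] as an
    unmatched vertex. *)
Lemma missed_indep w z : missed w -> missed z -> c w z != 1.
Proof.
move=> wm zm; apply/eqP => cwz.
have [zx [M' [M'P M'M _ zz]]] := zm.
have := x_max cP M'P M'M zz; rewrite leqNgt => /negP; apply.
have := @missed_degree [set w] w z zx (set11 w); rewrite cards1 addn1; apply.
by move=> y /set1P ->; rewrite (col_sym cP).
Qed.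

(* Otherwise [z] pays for handing the partner of [v] over to [w], and [v]
   becomes the unmatched vertex instead of [w]. *)
Lemma missed_dominated w v z : missed w -> q x < q v -> v != w ->
  c w z = 1 -> z != v -> c v z != 0.
Proof.
case=> wx [M' [M'P M'M xx ww]] xv vw cwz zv; apply/eqP => cvz.
have M'i := M'P.1.
have M'v : M' v != v.
  by apply: contraTneq xv => vv; rewrite -leqNgt; exact: (x_max cP M'P M'M vv).
have wz : z != w by apply/eqP => E; rewrite E (col_diag cP) in cwz.
have M'vw : M' v != w by rewrite (inv_eq M'i) ww.
(* With [v] and [w] as [a] and [b], the vertex [z] is both start and end of a one-vertex trail. *)
have [c' [c'P cwM keep]] : transfer m q c v w (M' v).
  apply: (transfer_trail cP (y := z) (z := z)) => //.
  - exact: M'P.2.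
  - by right; split=> //; apply/innerP.
  - by rewrite inE connect0.
have sP : matching c' (shift M' v w).
  apply: (matching_shift _ _ _ M'P (col_sym c'P)) => // y yv yw yMv cy.
  apply: keep => //.
  - by rewrite (inv_eq M'i) ww.
  - by case=> yE; rewrite yE eqxx in yv.
  - by case=> yE; rewrite yE eqxx in yMv.
have := x_max c'P sP _ (shift_fix M'v ww).
by rewrite unmatched_shift // leqNgt xv => /(_ M'M).
Qed.

(** Two edges of an alternating walk at once: a colour-1 edge from [w] to [N w'], then the matching
    edge to [w']. *)
Definition even_step (N : V -> V) : rel V := fun w w' =>
  (N w' != w') && (c w (N w') == 1).

(** Shifting the matching along the first step makes [w1] unmatched instead of [w]; the rest of the
    path must then be alternating for the new matching. *)
Lemma even_path_last N w p :
  matching c N -> #|unmatched N| = #|unmatched M| -> N x = x -> N w = w ->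
  w != x -> path (even_step N) w p -> uniq (w :: p) ->
  (forall v, v \in belast w p -> missed v) -> missed (last w p).
Proof.
elim: p N w => [|w1 p IH] N w NP NM xx ww wx; first by split=> //; exists N.
have Ni := NP.1.
case/andP=> /andP[Nw1 /eqP cw] pp /andP[wp up] miss.
have mw : missed w by apply: miss; rewrite mem_head.
have ww1 : w1 != w by apply: contraNneq wp => ->; rewrite mem_head.
have w1x : w1 != x by apply: contraNneq Nw1 => ->; rewrite xx.
apply: (IH (shift N w1 w)) => //.
- apply: (matching_shift _ _ _ NP (col_sym cP)) => //.
- by rewrite unmatched_shift.
- by rewrite shift_id // 1?eq_sym // (inv_eq Ni) xx.
- exact: shift_fix.
- apply: sub_belast_path pp => s t sp tp /andP[Nt /eqP cs].
  have tw1 : t != w1 by apply: contraTneq tp => ->; case/andP: up.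
  have tw : t != w by apply: contraNneq wp => <-; rewrite inE tp orbT.
  (* Otherwise [s] and [w1] would be adjacent missed vertices: independence excludes blossoms. *)
  have tN : t != N w1.
    apply/eqP => tE; rewrite tE Ni in cs.
    have sm : missed s by apply: miss; rewrite inE sp orbT.
    have w1m : missed w1.
      apply: miss; rewrite inE; case: (p) tp => // t' p' _.
      by rewrite mem_head orbT.
    by have := missed_indep sm w1m; rewrite cs.
  by rewrite /even_step shift_id // Nt cs eqxx.
- by move=> v vp; apply: miss; rewrite inE vp orbT.
Qed.

Lemma even_path_missed u p : M u = u -> u != x ->
  path (even_step M) u p -> uniq (u :: p) ->
  forall v, v \in u :: p -> missed v.
Proof.
move=> Mu ux; elim/last_ind: p => [|p t IH].
  by move=> _ _ v; rewrite inE => /eqP ->; split=> //; exists M.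
move=> pp up v; rewrite -rcons_cons mem_rcons inE => /orP[/eqP ->|]; last first.
  apply: IH; first by move: pp; rewrite rcons_path => /andP[].
  by move: up; rewrite -rcons_cons rcons_uniq => /andP[].
rewrite -(last_rcons u p t); apply: (even_path_last MP _ Mx Mu) => // y.
rewrite belast_rcons; apply: IH.
  by move: pp; rewrite rcons_path => /andP[].
by move: up; rewrite -rcons_cons rcons_uniq => /andP[].
Qed.

Lemma connect_missed u w : M u = u -> u != x ->
  connect (even_step M) u w -> missed w.
Proof.
move=> Mu ux /connectP[p pp ->]; case/shortenP: pp => p' pp' up' _.
by apply: (even_path_missed Mu ux pp' up'); exact: mem_last.
Qed.

(* The set [D] of vertices reached from [u] by even alternating walks is
   independent in the rest and has fewer than [#|D|] neighbours there. *)
Lemma deficient_neighbor delta u : M u = u -> u != x -> 0 < delta ->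
  (forall v, delta <= q v) ->
  exists z (T : {set V}), [/\ z != x, delta < #|T|
    & forall y, y \in T -> missed y /\ c z y = 1].
Proof.
move=> Mu ux d0 dq; have Mi := MP.1.
pose D := [set w | connect (even_step M) u w].
have Dm w : w \in D -> missed w by rewrite inE; exact: connect_missed.
pose A := [set z | [exists w in D, c w z == 1]].
have AP z : z \in A -> exists2 w, w \in D & c w z = 1.
  by rewrite inE => /exists_inP[w wD /eqP cw]; exists w.
have Ax z : z \in A -> z != x.
  case/AP=> w /Dm wm cw; apply/eqP => E.
  by have := missed_rest wm; rewrite -E cw.
have AM z : z \in A -> M z != z.
  move=> zA; have [w /Dm wm cw] := AP z zA; apply/eqP => Mz.
  have zm : missed z by split; [exact: Ax | exists M].
  by have := missed_indep wm zm; rewrite cw.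
have uD : u \in D by rewrite inE connect0.
(* One more alternating step leads back into [D]; [u], being unmatched, is not hit, which makes [A]
   strictly smaller than [D]. *)
have MA : M @: A \subset D :\ u.
  apply/subsetP => _ /imsetP[z zA ->]; have [w wD cw] := AP z zA.
  rewrite !inE (inv_eq Mi) Mu; apply/andP; split.
    by apply/eqP => E; have := AM z zA; rewrite E Mu eqxx.
  rewrite inE in wD; apply: connect_trans wD (connect1 _).
  by rewrite /even_step Mi cw eqxx eq_sym AM.
have AD : #|A| < #|D|.
  rewrite (cardsD1 u D) uD -(card_imset A (inv_inj Mi)).
  exact: subset_leq_card MA.
(* Double counting of the colour-1 pairs between [D] and [A]. *)
have sumDA : \sum_(w in D) q w = \sum_(z in A) #|[set w in D | c z w == 1]|.
  under [RHS]eq_bigr => z _ do rewrite card_setsum.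
  rewrite exchange_big /=; apply: eq_bigr => w wD.
  rewrite -card_setsum -(col_rest cP); apply: eq_card => z.
  rewrite [RHS]in_set in_set (col_sym cP z w).
  case: eqP => cw; rewrite ?andbF ?andbT //; apply/esym.
  by rewrite inE; apply/exists_inP; exists w => //; apply/eqP.
have [z zA zd] : exists2 z, z \in A & delta < #|[set w in D | c z w == 1]|.
  apply/exists_inP; apply: contraT; rewrite negb_exists_in => /forall_inP small.
  have: \sum_(w in D) delta <= \sum_(z in A) delta.
    apply: leq_trans (_ : \sum_(w in D) q w <= _); first exact: leq_sum.
    rewrite sumDA; apply: leq_sum => z /small; by rewrite -leqNgt.
  by rewrite !sum_nat_const leq_mul2r leqNgt AD; case: (delta) d0.
exists z, [set w in D | c z w == 1]; split=> //; first exact: Ax.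
by move=> y; rewrite in_set => /andP[/Dm ym /eqP].
Qed.

Lemma deficient_false delta s u : M u = u -> u != x -> 0 < delta ->
  (forall v, delta <= q v <= delta + s) ->
  s + m < #|[set v | s <= q v]| -> False.
Proof.
move=> Mu ux d0 dq big.
have [v|z [T [zx dT TP]]] := deficient_neighbor Mu ux d0.
  by case/andP: (dq v).
have [y yT] : exists y, y \in T by apply/card_gt0P; apply: leq_trans dT.
have qxz := missed_degree zx yT TP.
have qz : q z <= delta + s by case/andP: (dq z).
have qx : q x < s by lia.
have [ym cy] := TP y yT.
have low w : missed w -> q w <= q x.
  by case=> _ [M' [M'P M'M _ ww]]; exact: (x_max cP M'P M'M ww).
pose B := [set v | s <= q v].
have BT : (B :\ z) :&: T = set0.
  apply/setP => v; rewrite !inE; apply/negP => /andP[/andP[_ sv] /TP[vm _]].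
  by have := low _ vm; lia.
have BTz : (B :\ z) :|: T \subset [set w | 0 < c z w].
  apply/subsetP => v; rewrite in_setU => vBT; rewrite in_set.
  case/orP: vBT => [|/TP[_ ->]//].
  rewrite in_setD1 in_set => /andP[vz sv]; rewrite lt0n (col_sym cP).
  apply: (missed_dominated ym) => //.
  - exact: leq_trans sv.
  - apply: contraTneq sv => ->; have := low _ ym; lia.
  - by rewrite (col_sym cP).
  - by rewrite eq_sym.
(* At least [s + m] vertices from [B :\ z] and [delta + 1] from [T] exceed [q z + m]. *)
have := subset_leq_card BTz; rewrite cardsU BT cards0 subn0 (card_colored z cP).
have := cardsD1 z B; move: big; rewrite -/B; case: (z \in B) => /=; lia.
Qed.

End Deficient.

(** * Extremal choice and splitting off one 1-factor *)

Lemma exists_minimal (T : Type) (P : T -> Prop) (f : T -> nat) :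
  (exists t, P t) -> exists2 t, P t & forall t', P t' -> f t <= f t'.
Proof.
case=> t; have [k] := ubnP (f t); elim: k t => // k IH t ftk Pt.
case: (classic (exists2 t', P t' & f t' < f t)) => [[t' Pt' lt]|no].
  by apply: (IH t') => //; apply: leq_trans lt _.
exists t => // t' Pt'; rewrite leqNgt; apply/negP => lt; apply: no.
by exists t'.
Qed.

Lemma split_factor (V : finType) m q (c : V -> V -> nat) delta s :
  coloring m q c -> ~~ odd #|V| -> 0 < delta ->
  (forall v, delta <= q v <= delta + s) ->
  s + m < #|[set v | s <= q v]| ->
  exists c', coloring m.+1 (fun v => (q v).-1) c'.
Proof.
move=> cP Veven d0 dq big.
pose state (t : (V -> V -> nat) * (V -> V)) :=
  coloring m q t.1 /\ matching t.1 t.2.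
have [|[c1 M1] [/= c1P M1P] /= min1] :=
  @exists_minimal _ state (fun t => #|unmatched t.2|).
  by exists (c, id); split=> //; split=> // v; rewrite eqxx.
have [M0|[x0]] := set_0Vmem (unmatched M1).
  have Mi := M1P.1; have M1n v : M1 v != v.
    by apply/negP => Mv; have := in_set0 v; rewrite -M0 inE Mv.
  (* A perfect matching of the rest becomes the new colour class. *)
  exists (fun v w => if w == M1 v then m.+2 else c1 v w).
  have cM v : c1 v (M1 v) = 1 by exact: M1P.2.
  have cm v w : (c1 v w == m.+2) = false.
    by apply/eqP => E; have := col_le c1P v w; rewrite E ltnn.
  split.
  - by move=> v w; rewrite -(inv_eq Mi) eq_sym (col_sym c1P).
  - by move=> v; rewrite eq_sym (negbTE (M1n v)) (col_diag c1P).
  - move=> v w; case: ifP => // _; exact: leq_trans (col_le c1P v w) _.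
  - move=> v; rewrite -(col_rest c1P v) (cardsD1 (M1 v) [set w | c1 v w == 1]).
    rewrite inE cM eqxx /=; apply: eq_card => w; rewrite !inE.
    by case: (w == M1 v).
  move=> v j /andP[j1 jm]; have [jE|jE] := eqVneq j m.+2.
    apply/eqP/cards1P; exists (M1 v); apply/setP => w; rewrite !inE jE.
    by case: (w == M1 v); rewrite ?eqxx ?cm.
  rewrite -(col_factor c1P v (j := j)); last by lia.
  apply: eq_card => w; rewrite !inE; have [->|//] := eqVneq w (M1 v).
  by rewrite cM eq_sym (negbTE jE); case: (j) j1 => [|[]].
rewrite inE => /eqP M1x0.
pose best (t : (V -> V -> nat) * (V -> V) * V) :=
  [/\ state t.1, #|unmatched t.1.2| = #|unmatched M1| & t.1.2 t.2 = t.2].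
(* Since [q] never exceeds [delta + s], minimising this difference maximises [q]. *)
have [|[[c2 M2] x] /= [[/= c2P M2P] M2c Mx] min2] :=
  @exists_minimal _ best (fun t => delta + s - q t.2).
  by exists (c1, M1, x0).
(* Parity supplies a second unmatched vertex [u]. *)
have: 1 < #|unmatched M2|.
  have := odd_unmatched M2P.1; rewrite (negbTE Veven).
  by rewrite (cardsD1 x) inE Mx eqxx; case: #|_|.
rewrite (cardsD1 x) inE Mx eqxx ltnS => /card_gt0P[u].
rewrite !inE => /andP[ux /eqP Mu]; exfalso.
apply: (@deficient_false V m q c2 M2 x c2P M2P Mx _ _ delta s u) => //.
  by move=> c' M' c'P M'P; rewrite M2c; apply: (min1 (c', M')).
move=> c' M' v c'P M'P M'M vv; rewrite M2c in M'M.
have /= := min2 (c', M', v); move/(_ (And3 (conj c'P M'P) M'M vv)).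
by have := dq v; have := dq x; lia.
Qed.

(** * Degree sequences *)

Lemma coloring_ext (V : finType) m (q q' : V -> nat) c :
  q =1 q' -> coloring m q c -> coloring m q' c.
Proof. by move=> qq' [? ? ? r ?]; split=> // v; rewrite r qq'. Qed.

Lemma split_factors (V : finType) k (h : V -> nat) c b s :
  coloring 0 h c -> ~~ odd #|V| -> k <= b ->
  (forall v, b <= h v <= b + s) -> s + k <= #|[set v | s + k <= (h v).+1]| ->
  exists c', coloring k (fun v => h v - k) c'.
Proof.
move=> cP Veven kb hb big.
suff: forall m, m <= k -> exists c', coloring m (fun v => h v - m) c' by apply.
elim=> [_|m IH mk].
  by exists c; apply: coloring_ext cP => v; rewrite subn0.
have [c' c'P] := IH (ltnW mk).
have [|v||c'' c''P] := split_factor (delta := b - m) (s := s) c'P Veven.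
- by rewrite subn_gt0 (leq_trans mk).
- by have := hb v; lia.
(* As [m < k], any [v] with [h v >= s + k - 1] has [h v - m >= s]: the same vertices serve at every
   stage. *)
- apply: leq_trans (leq_trans big (subset_leq_card _)); first by lia.
  by apply/subsetP => v; rewrite !inE; lia.
by exists c''; apply: coloring_ext c''P => v; lia.
Qed.

Lemma card_top n r : r <= n -> r <= #|[set v : 'I_n | n - r <= v]|.
Proof.
move=> rn; pose f (i : 'I_r) := rev_ord (widen_ord rn i).
have fi : injective f.
  by move=> i j /rev_ord_inj/(congr1 val) ij; exact: val_inj.
rewrite -[X in X <= _](card_ord r) -(card_imset _ fi).
apply/subset_leq_card/subsetP => _ /imsetP[i _ ->]; rewrite inE /=.
have := ltn_ord i; lia.
Qed.

Lemma degree_compl n (g : rel 'I_n) v : irreflexive g ->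
  #|[set w | (v != w) && ~~ g v w]| = n.-1 - degree g v.
Proof.
move=> gi; rewrite /degree.
have -> : n.-1 = #|[set: 'I_n] :\ v|.
  by rewrite -[in LHS](card_ord n) -cardsT (cardsD1 v) in_setT.
rewrite -(cardsID [set w | g v w] (_ :\ v)).
rewrite (_ : _ :&: _ = [set w | g v w]) ?addKn; last first.
  by apply/setP => w; rewrite !inE; case: eqP => // ->; rewrite gi.
by apply: eq_card => w; rewrite !inE andbT eq_sym andbC.
Qed.

(* The subtractions below are on nat, but none of them truncates: d is
   non-increasing, and graphicness of d and of Dk k d gives
   k <= d_n <= d_1 <= n - 1, hence 0 <= d_1 - d_n and d_1 - d_n + k <= n - 1. *)
Theorem theorem1p8 (n k : nat) (d : n.-tuple nat)
  (n_gt0 : 0 < n) (n_even : ~~ odd n) (k_gt0 : 0 < k)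
  (d_noninc : sorted geq d) (d_pos : all (leq 1) d)
  (d_graphic : graphic (to_int d)) (Dk_graphic : graphic (Dk k d))
  (d_bound : entry d (n + 1 - (entry d 1 - entry d n + k))
             <= n - (entry d 1 - entry d n)) :
  exists (e : rel 'I_n) (F : 'I_k -> rel 'I_n),
    [/\ realizes e (to_int d),
        forall i : 'I_k, one_factor e (F i)
      & forall i j : 'I_k, i != j -> edge_disjoint (F i) (F j)].
Proof.
have mono i j : i <= j -> j < n -> nth 0 d j <= nth 0 d i.
  move=> ij jn; apply: (sorted_leq_nth (leT := geq)) => //.
  - by move=> x y z xy yz; exact: leq_trans yz xy.
  - by move=> x; exact: leqnn.
  - by rewrite inE size_tuple (leq_ltn_trans ij).
  - by rewrite inE size_tuple.
have [g [[gs gi] gd]] := Dk_graphic.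
have dg (v : 'I_n) : degree g v + k = nth 0 d v.
  by have := gd v; rewrite !tnth_map (tnth_nth 0); lia.
have dn (v : 'I_n) : nth 0 d v <= n.-1.
  have [f [[_ fi] fd]] := d_graphic.
  have := fd v; rewrite tnth_map (tnth_nth 0) => -[<-].
  have -> : n.-1 = #|[set: 'I_n] :\ v|.
    by rewrite -[in LHS](card_ord n) -cardsT (cardsD1 v) in_setT.
  rewrite /degree; apply/subset_leq_card/subsetP => w; rewrite !inE andbT.
  by apply: contraTneq => ->; rewrite fi.
have d1 : entry d 1 <= n.-1 := dn (Ordinal n_gt0).
have n1 : n.-1 < n by lia.
have kd : k <= entry d n by rewrite /entry -(dg (Ordinal n1)) leq_addl.
have range (v : 'I_n) : entry d n <= nth 0 d v <= entry d 1.
  by rewrite /entry !mono //; have := ltn_ord v; lia.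
set s := entry d 1 - entry d n in d_bound.
have rn : s + k <= n by rewrite /s; have := range (Ordinal n_gt0); lia.
pose c (v w : 'I_n) : nat := (v != w) && ~~ g v w.
pose h (v : 'I_n) := n.-1 - degree g v.
have cP : coloring 0 h c.
  split=> [v w|v|v w|v|v j]; rewrite /c.
  - by rewrite eq_sym gs.
  - by rewrite eqxx.
  - by case: (_ && _).
  - rewrite /h -(degree_compl v gi); apply: eq_card => w; rewrite !inE.
    by case: (_ && _).
  - by case: j => [|[]].
have hE (v : 'I_n) : h v = n.-1 + k - nth 0 d v.
  by rewrite /h -dg; have := dg v; have := dn v; lia.
(* The bound [n.-1 + k - entry d 1] is the complement degree belonging to the largest entry; it is
   at least [k] because [entry d 1 <= n.-1]. *)
have [||v||c' [c's c'0 c'le c'q c'1]] :=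
  @split_factors _ k h c (n.-1 + k - entry d 1) s cP.
- by rewrite card_ord.
- by lia.
- by rewrite hE /s; have := range v; have := dn v; lia.
(* The one-based index [n + 1 - (s + k)] is the zero-based [n - (s + k)], so by monotonicity the
   hypothesis bounds the last [s + k] entries. *)
- apply: leq_trans (card_top rn) (subset_leq_card _).
  apply/subsetP => v; rewrite !inE => sv.
  have : nth 0 d v <= entry d (n + 1 - (s + k)).
    by apply: mono => //; lia.
  by rewrite hE; lia.
have irr j : irreflexive (fun v w => c' v w == j.+2) by move=> v; rewrite c'0.
(* Colour 1 has degree [h v - k], that is [n.-1 - nth 0 d v], so its complement realizes [d] and
   contains all the higher colours. *)
exists (fun v w => (v != w) && (c' v w != 1)), (fun i v w => c' v w == i.+2).
split.
- split; first by split=> [v w|v]; rewrite ?eqxx // eq_sym c's.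
  move=> v; rewrite tnth_map (tnth_nth 0) /degree; congr Posz.
  rewrite (@degree_compl n (fun v w => c' v w == 1)) ?/degree.
    rewrite c'q hE; have := dn v; have := dg v; lia.
  by move=> w; rewrite c'0.
- move=> i; split.
  + by split=> [v w|//]; rewrite c's.
  + move=> v w /eqP cw; rewrite cw andbT.
    by apply: contraTneq isT => vw; rewrite vw c'0 in cw.
  + by move=> v; rewrite /degree c'1 //= ltnS.
move=> i j ij v w; apply: contra ij => /andP[/eqP -> /eqP[ij]].
exact/eqP/val_inj.
Qed.
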